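(* Let $N\ge2$ and $n\ge1$ be integers, $\sigma,B,\lambda>0$, $\rho=n/\sigma^2$ and $\kappa=\sqrt{2\ln(1.25\,n^2)}\,B/n$. Consider the problem of maximizing, over a common noise level $\alpha\in(0,\infty]$ (equivalently over $\beta=\frac{1}{1/\rho+\alpha^2}\in[0,\rho)$, with $\alpha=\infty$ corresponding to $\beta=0$), the common utility $$u(\alpha)=-\frac{\kappa^2}{\alpha^2}-\frac{\lambda}{(N-1)\beta+\rho}\qquad\text{subject to}\qquad u(\alpha)\ge u^0=-\frac{\lambda}{\rho},$$ and denote the optimal values by $\alpha^*$ and $\beta^*$. (1) If $(N-1)\lambda\le\kappa^2\rho^2$, collaboration is unprofitable: $\beta^*=0$. (2) If $(N-1)\lambda>\kappa^2\rho^2$, collaboration is profitable, with $$(\alpha^* )^2=\frac{N\kappa}{\sqrt{(N-1)\lambda}-\kappa\rho}.$$ In this case $$u(\alpha^* )-u^0=\frac{\left(\sqrt{(N-1)\lambda}-\kappa\rho\right)^2}{N\rho},\qquad \frac{d(\alpha^* )^2}{d\lambda}\le0,$$ $$\operatorname{sign}\frac{d(\alpha^* )^2}{dN}=\operatorname{sign}\left((N-2)\sqrt\lambda-2\sqrt{N-1}\,\kappa\rho\right),$$ where in the last derivative $N$ is treated as a real variable in the formula for $(\alpha^* )^2$ and $\lambda,\kappa,\rho$ are held fixed.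
   Context: Setting (symmetric differentially private mean estimation). Each of $N$ clients holds $n$ independent samples with mean $\mu$, variance $\sigma^2$, supported in $[\mu-B/2,\mu+B/2]$, and reveals its sample mean plus $N(0,\alpha^2)$ noise, with the same $\alpha$ and the same accuracy weight $\lambda$ for all clients. The privacy loss is $\mathrm{Leak}=\kappa/\alpha$, the squared accuracy loss is $\mathrm{Err}^2=\frac{1}{(N-1)\beta+\rho}$, the utility is $u=-\mathrm{Leak}^2-\lambda\,\mathrm{Err}^2$, and $u^0$ is the utility of training alone. *)

(* Defs.v *)
From Stdlib Require Import Reals Lra Psatz.
From Coquelicot Require Import Coquelicot.
Open Scope R_scope.

(* Noise levels live in (0, +oo]: they are elements [alpha : Rbar] with
   [Rbar_lt 0 alpha].  The value at [m_infty] is irrelevant. *)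

Definition leak (kappa : R) (alpha : Rbar) : R :=
  match alpha with
  | Finite a => kappa / a
  | _ => 0
  end.

Definition beta (rho : R) (alpha : Rbar) : R :=
  match alpha with
  | Finite a => 1 / (1 / rho + a ^ 2)
  | _ => 0
  end.

Definition err_sq (N : nat) (rho b : R) : R :=
  1 / ((INR N - 1) * b + rho).

Definition utility (N : nat) (kappa rho lambda : R) (alpha : Rbar) : R :=
  - leak kappa alpha ^ 2 - lambda * err_sq N rho (beta rho alpha).

Definition utility_alone (rho lambda : R) : R := - lambda / rho.

Definition feasible (N : nat) (kappa rho lambda : R) (alpha : Rbar) : Prop :=
  Rbar_lt 0 alpha /\
  utility N kappa rho lambda alpha >= utility_alone rho lambda.

Definition optimal (N : nat) (kappa rho lambda : R) (alpha : Rbar) : Prop :=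
  feasible N kappa rho lambda alpha /\
  forall alpha' : Rbar, feasible N kappa rho lambda alpha' ->
    utility N kappa rho lambda alpha' <= utility N kappa rho lambda alpha.

(* Some common noise level is strictly better than training alone. *)
Definition profitable (N : nat) (kappa rho lambda : R) : Prop :=
  exists alpha : Rbar, Rbar_lt 0 alpha /\
    utility N kappa rho lambda alpha > utility_alone rho lambda.

(* The number of clients [x] is real, so that one can differentiate in it. *)
Definition optimal_noise_sq (x kappa rho lambda : R) : R :=
  x * kappa / (sqrt ((x - 1) * lambda) - kappa * rho).

(* [beta rho] is a bijection from (0, +oo] onto [0, rho), so maximizing over
   the noise level is the same as maximizing over the value of [beta]. *)
Lemma beta_bijection (rho : R) (hrho : 0 < rho) :
  (forall alpha : Rbar, Rbar_lt 0 alpha -> 0 <= beta rho alpha < rho) /\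
  (forall b : R, 0 <= b < rho ->
     exists! alpha : Rbar, Rbar_lt 0 alpha /\ beta rho alpha = b).
Proof.
assert (hir : 0 < 1 / rho) by (apply Rdiv_lt_0_compat; lra).
assert (pos : forall a, 0 < 1 / (1 / rho + a ^ 2)).
{ intro a. apply Rdiv_lt_0_compat; nra. }
split.
- intros [a| |] ha; simpl in ha; try contradiction; unfold beta; [|lra].
  split; [left; apply pos|].
  apply Rmult_lt_reg_r with (1 / rho + a ^ 2); [nra|].
  replace (1 / (1 / rho + a ^ 2) * (1 / rho + a ^ 2)) with 1 by (field; nra).
  replace (rho * (1 / rho + a ^ 2)) with (1 + rho * a ^ 2) by (field; lra).
  assert (0 < a ^ 2) by nra. nra.
- intros b [hb0 hb].
  destruct (Req_dec b 0) as [->|hb1].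
  + exists p_infty. split; [simpl; auto|].
    intros [a| |] [ha hab]; simpl in ha; try contradiction; [|reflexivity].
    exfalso; unfold beta in hab; specialize (pos a); lra.
  + assert (hd : 0 < 1 / b - 1 / rho).
    { replace (1 / b - 1 / rho) with ((rho - b) / (b * rho)) by (field; lra).
      apply Rdiv_lt_0_compat; nra. }
    exists (Finite (sqrt (1 / b - 1 / rho))). split.
    * split; [simpl; apply sqrt_lt_R0; exact hd|].
      unfold beta. rewrite pow2_sqrt by lra. field; repeat split; try lra.
    * intros [a| |] [ha hab]; simpl in ha; try contradiction.
      -- f_equal. rewrite <- hab. unfold beta.
         replace (1 / (1 / (1 / rho + a ^ 2)) - 1 / rho) with (a ^ 2)
           by (field; repeat split; nra).
         apply sqrt_pow2; lra.
      -- exfalso. apply hb1. simpl in hab. auto.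
Qed.

(* Main.v *)
Require Import Defs.
From Stdlib Require Import Reals Lra.
From Coquelicot Require Import Coquelicot.
Open Scope R_scope.

(** With [t = alpha^2] and [s = sqrt ((N - 1) lambda)], the gain over training alone is
    [s^2 / (rho (N + rho t)) - kappa^2 / t].  Its numerator over the common denominator is
    [(s^2 - kappa^2 rho^2) t - N kappa^2 rho], negative for all [t > 0] when
    [s <= kappa rho].  Otherwise the Cauchy-Schwarz inequality
    [(kappa rho)^2 / (rho t) + (s - kappa rho)^2 / N >= s^2 / (rho t + N)]
    bounds the gain by [(s - kappa rho)^2 / (N rho)], with equality only at
    [t = N kappa / (s - kappa rho)]. *)

Lemma utility_p_infty N kappa rho lambda :
  0 < rho -> utility N kappa rho lambda p_infty = utility_alone rho lambda.
Proof.
  intro hr. unfold utility, utility_alone, err_sq, leak, beta. field. lra.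
Qed.

Lemma utility_gain N kappa rho lambda a :
  1 <= INR N -> 0 < rho -> 0 < a ->
  utility N kappa rho lambda (Finite a) - utility_alone rho lambda
  = (INR N - 1) * lambda / (rho * (INR N + rho * a ^ 2)) - kappa ^ 2 / a ^ 2.
Proof.
  intros hN hr ha. assert (0 < rho * a ^ 2) by (apply Rmult_lt_0_compat; nra).
  unfold utility, utility_alone, err_sq, leak, beta. field.
  repeat split; try lra; nra.
Qed.

Lemma utility_gain_neg N kappa rho lambda a :
  1 <= INR N -> 0 < rho -> 0 < kappa -> 0 < a ->
  (INR N - 1) * lambda <= kappa ^ 2 * rho ^ 2 ->
  utility N kappa rho lambda (Finite a) < utility_alone rho lambda.
Proof.
  intros hN hr hk ha hle. apply Rminus_lt. rewrite utility_gain by assumption.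
  assert (ht : 0 < a ^ 2) by nra. set (t := a ^ 2) in *. clearbody t.
  assert (hrt : 0 < rho * t) by nra.
  replace ((INR N - 1) * lambda / (rho * (INR N + rho * t)) - kappa ^ 2 / t)
    with (- (((kappa ^ 2 * rho ^ 2 - (INR N - 1) * lambda) * t + INR N * kappa ^ 2 * rho)
             / (t * (rho * (INR N + rho * t)))))
    by (field; repeat split; lra).
  apply Ropp_lt_gt_0_contravar, Rdiv_lt_0_compat.
  - assert (0 < INR N * kappa ^ 2 * rho) by (repeat apply Rmult_lt_0_compat; nra). nra.
  - repeat apply Rmult_lt_0_compat; lra.
Qed.

(** This is the Cauchy-Schwarz bound with its defect written out as a square over a positive
    denominator. The square yields both optimality, since it is nonnegative, and uniqueness, since
    it vanishes for a single value of [a ^ 2]. *)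
Lemma utility_gain_square N kappa rho lambda a :
  1 <= INR N -> 0 < rho -> 0 < lambda -> 0 < a ->
  let s := sqrt ((INR N - 1) * lambda) in
  utility N kappa rho lambda (Finite a) - utility_alone rho lambda
  = (s - kappa * rho) ^ 2 / (INR N * rho)
    - (INR N * kappa - (s - kappa * rho) * a ^ 2) ^ 2
      / (a ^ 2 * INR N * (INR N + rho * a ^ 2)).
Proof.
  intros hN hr hl ha s. rewrite utility_gain by assumption.
  assert (hs : (INR N - 1) * lambda = s ^ 2) by (symmetry; apply pow2_sqrt; nra).
  rewrite hs. assert (ht : 0 < a ^ 2) by nra. clearbody s.
  assert (0 < rho * a ^ 2) by nra. field. repeat split; lra.
Qed.

(** Puts the profitability threshold in the form that makes the denominator of [optimal_noise_sq]
    positive. *)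
Lemma threshold_sqrt x kappa rho lambda :
  0 <= kappa -> 0 <= rho ->
  kappa ^ 2 * rho ^ 2 < (x - 1) * lambda -> kappa * rho < sqrt ((x - 1) * lambda).
Proof.
  intros hk hr hlt. rewrite <- (sqrt_pow2 (kappa * rho)) by nra.
  apply sqrt_lt_1_alt. nra.
Qed.

Lemma optimal_noise_sq_pos x kappa rho lambda :
  0 < x -> 0 < kappa -> kappa * rho < sqrt ((x - 1) * lambda) ->
  0 < optimal_noise_sq x kappa rho lambda.
Proof. intros. apply Rdiv_lt_0_compat; nra. Qed.

Lemma utility_optimal_noise N kappa rho lambda :
  1 <= INR N -> 0 < rho -> 0 < kappa -> 0 < lambda ->
  kappa * rho < sqrt ((INR N - 1) * lambda) ->
  utility N kappa rho lambda (sqrt (optimal_noise_sq (INR N) kappa rho lambda))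
    - utility_alone rho lambda
  = (sqrt ((INR N - 1) * lambda) - kappa * rho) ^ 2 / (INR N * rho).
Proof.
  intros hN hr hk hl hs.
  assert (hq : 0 < optimal_noise_sq (INR N) kappa rho lambda)
    by (apply optimal_noise_sq_pos; lra).
  rewrite utility_gain_square by (try apply sqrt_lt_R0; assumption).
  rewrite pow2_sqrt by lra. set (q := optimal_noise_sq _ _ _ _) in *.
  (* By its definition [q] solves [(s - kappa * rho) * q = N * kappa], with [s] the square root, so
     the defect vanishes. *)
  replace (INR N * kappa - _ * q) with 0
    by (unfold q, optimal_noise_sq; field; lra).
  assert (0 < rho * q) by nra. field. repeat split; lra.
Qed.

Lemma optimal_p_infty N kappa rho lambda :
  1 <= INR N -> 0 < rho -> 0 < kappa ->
  (INR N - 1) * lambda <= kappa ^ 2 * rho ^ 2 ->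
  unique (optimal N kappa rho lambda) p_infty.
Proof.
  intros hN hr hk hle. split.
  - split.
    + split; [exact I|]. rewrite utility_p_infty by assumption. lra.
    + intros [a| |] [ha hu]; simpl in ha; try contradiction; [|lra].
      rewrite utility_p_infty by assumption. left. now apply utility_gain_neg.
  (* Finite noise levels lose strictly against training alone, so none is even feasible. *)
  - intros [a| |] [[ha hu] _]; simpl in ha; try contradiction; [|reflexivity].
    pose proof (utility_gain_neg N kappa rho lambda a hN hr hk ha hle). lra.
Qed.

Lemma optimal_finite N kappa rho lambda :
  1 <= INR N -> 0 < rho -> 0 < kappa -> 0 < lambda ->
  kappa * rho < sqrt ((INR N - 1) * lambda) ->
  unique (optimal N kappa rho lambda)
    (sqrt (optimal_noise_sq (INR N) kappa rho lambda)).
Proof.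
  intros hN hr hk hl hs.
  assert (hq : 0 < optimal_noise_sq (INR N) kappa rho lambda)
    by (apply optimal_noise_sq_pos; lra).
  pose proof (utility_optimal_noise N kappa rho lambda hN hr hk hl hs) as hopt.
  set (q := optimal_noise_sq _ _ _ _) in *.
  set (s := sqrt ((INR N - 1) * lambda)) in *.
  (* The strictly positive gain makes [sqrt q] feasible and rules out [p_infty], whose gain is
     zero. *)
  assert (hG : 0 < (s - kappa * rho) ^ 2 / (INR N * rho))
    by (apply Rdiv_lt_0_compat; nra).
  assert (hden : forall a, 0 < a -> 0 < a ^ 2 * INR N * (INR N + rho * a ^ 2)).
  { intros a ha. assert (0 < a ^ 2) by nra. assert (0 < rho * a ^ 2) by nra.
    repeat apply Rmult_lt_0_compat; lra. }
  assert (hfeas : feasible N kappa rho lambda (sqrt q))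
    by (split; [apply sqrt_lt_R0; assumption | lra]).
  split.
  - split; [exact hfeas|].
    intros [a| |] [ha _]; simpl in ha; try contradiction.
    + pose proof (utility_gain_square N kappa rho lambda a hN hr hl ha) as h.
      cbv zeta in h. fold s in h.
      assert (0 <= (INR N * kappa - (s - kappa * rho) * a ^ 2) ^ 2
                   / (a ^ 2 * INR N * (INR N + rho * a ^ 2)))
        by (apply Rdiv_le_0_compat; [apply pow2_ge_0 | auto]).
      lra.
    + rewrite utility_p_infty by assumption. lra.
  - intros [a| |] [[ha _] hmax]; simpl in ha; try contradiction;
      specialize (hmax _ hfeas).
    + pose proof (utility_gain_square N kappa rho lambda a hN hr hl ha) as h.
      cbv zeta in h. fold s in h. specialize (hden a ha).
      set (d := INR N * kappa - (s - kappa * rho) * a ^ 2) in *.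
      (* A competing maximizer must reach the bound attained at [sqrt q], which leaves no room for a
         positive defect. *)
      assert (hd : d = 0).
      { destruct (Req_dec d 0) as [|hd]; [assumption|exfalso].
        assert (0 < d ^ 2 / (a ^ 2 * INR N * (INR N + rho * a ^ 2)))
          by (apply Rdiv_lt_0_compat; [now apply pow2_gt_0 | assumption]).
        lra. }
      f_equal. rewrite <- (sqrt_pow2 a) by lra. f_equal.
      unfold q, optimal_noise_sq. fold s.
      apply Rmult_eq_reg_r with (s - kappa * rho); [|lra].
      field_simplify; [|lra]. unfold d in hd. lra.
    + rewrite utility_p_infty in hmax by assumption. lra.
Qed.

Lemma is_derive_optimal_noise_sq_weight x kappa rho lambda :
  0 < (x - 1) * lambda -> kappa * rho < sqrt ((x - 1) * lambda) ->
  is_derive (fun l => optimal_noise_sq x kappa rho l) lambda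
    (- (x * kappa * (x - 1)
        / (2 * sqrt ((x - 1) * lambda) * (sqrt ((x - 1) * lambda) - kappa * rho) ^ 2))).
Proof.
  intros hl hs. assert (0 < sqrt ((x - 1) * lambda)) by now apply sqrt_lt_R0.
  unfold optimal_noise_sq. auto_derive.
  - repeat split; lra.
  (* [auto_derive] writes [x + - (1)]; unfolding subtraction everywhere lets [field] see a single
     square root. *)
  - unfold Rminus in *. field. lra.
Qed.

(** The derivative is factored so that the first factor is positive when [kappa] is, and the second
    is the expression whose sign the theorem claims. *)
Lemma is_derive_optimal_noise_sq_clients x kappa rho lambda :
  1 < x -> 0 < lambda -> kappa * rho < sqrt ((x - 1) * lambda) ->
  is_derive (fun y => optimal_noise_sq y kappa rho lambda) x
    (kappa * sqrt lambda
       / (2 * sqrt ((x - 1) * lambda) * (sqrt ((x - 1) * lambda) - kappa * rho) ^ 2)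
     * ((x - 2) * sqrt lambda - 2 * sqrt (x - 1) * kappa * rho)).
Proof.
  intros hx hl hs. assert (hp : 0 < (x - 1) * lambda) by nra.
  assert (0 < sqrt ((x - 1) * lambda)) by now apply sqrt_lt_R0.
  unfold optimal_noise_sq. auto_derive.
  - repeat split; unfold Rminus in *; lra.
  - change (x + - (1)) with (x - 1).
    rewrite sqrt_mult in * by lra.
    (* With [m = sqrt (x - 1)] and [w = sqrt lambda] as the variables, every root becomes polynomial
       and the claim is an identity of rational functions. *)
    assert (hm : x = sqrt (x - 1) ^ 2 + 1) by (rewrite pow2_sqrt; lra).
    assert (hL : lambda = sqrt lambda ^ 2) by (rewrite pow2_sqrt; lra).
    assert (0 < sqrt (x - 1)) by (apply sqrt_lt_R0; lra).
    assert (0 < sqrt lambda) by now apply sqrt_lt_R0.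
    set (m := sqrt (x - 1)) in *. set (w := sqrt lambda) in *.
    clearbody m w. subst x lambda. field. lra.
Qed.

Lemma sign_pos_mult c x : 0 < c -> sign (c * x) = sign x.
Proof. intro hc. now rewrite sign_mult, (sign_eq_1 c hc), Rmult_1_l. Qed.

(** The constant 1.25 keeps the argument of the logarithm above 1 even for [n = 1]. *)
Lemma kappa_pos n B :
  (1 <= n)%nat -> 0 < B -> 0 < sqrt (2 * ln (1.25 * INR n ^ 2)) * B / INR n.
Proof.
  intros hn hB. apply le_INR in hn. simpl in hn.
  apply Rdiv_lt_0_compat; [|lra]. apply Rmult_lt_0_compat; [|assumption].
  apply sqrt_lt_R0, Rmult_lt_0_compat; [lra|].
  rewrite <- ln_1. apply ln_increasing; nra.
Qed.

Theorem mainTheorem4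
  (N n : nat) (sigma B lambda rho kappa : R)
  (hN : (2 <= N)%nat) (hn : (1 <= n)%nat)
  (hsigma : 0 < sigma) (hB : 0 < B) (hlambda : 0 < lambda)
  (hrho : rho = INR n / sigma ^ 2)
  (hkappa : kappa = sqrt (2 * ln (1.25 * INR n ^ 2)) * B / INR n) :
  (* the optimal noise level, as a function of the accuracy weight *)
  exists alpha_star : R -> Rbar,
    (forall l : R, 0 < l -> unique (optimal N kappa rho l) (alpha_star l)) /\
    ((INR N - 1) * lambda <= kappa ^ 2 * rho ^ 2 ->
       ~ profitable N kappa rho lambda /\
       beta rho (alpha_star lambda) = 0) /\
    ((INR N - 1) * lambda > kappa ^ 2 * rho ^ 2 ->
       profitable N kappa rho lambda /\
       is_finite (alpha_star lambda) /\
       real (alpha_star lambda) ^ 2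
         = optimal_noise_sq (INR N) kappa rho lambda /\
       utility N kappa rho lambda (alpha_star lambda) - utility_alone rho lambda
         = (sqrt ((INR N - 1) * lambda) - kappa * rho) ^ 2 / (INR N * rho) /\
       ex_derive (fun l : R => real (alpha_star l) ^ 2) lambda /\
       Derive (fun l : R => real (alpha_star l) ^ 2) lambda <= 0 /\
       ex_derive (fun x : R => optimal_noise_sq x kappa rho lambda) (INR N) /\
       sign (Derive (fun x : R => optimal_noise_sq x kappa rho lambda) (INR N))
         = sign ((INR N - 2) * sqrt lambda
                 - 2 * sqrt (INR N - 1) * kappa * rho)).
Proof.
  assert (hN1 : 2 <= INR N) by now apply (le_INR 2).
  assert (hr : 0 < rho).
  { rewrite hrho. apply Rdiv_lt_0_compat; [apply lt_0_INR; exact hn | nra]. }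
  assert (hk : 0 < kappa) by (rewrite hkappa; now apply kappa_pos).
  clear hrho hkappa.
  assert (hs : forall l, kappa ^ 2 * rho ^ 2 < (INR N - 1) * l ->
                 kappa * rho < sqrt ((INR N - 1) * l))
    by (intros; apply threshold_sqrt; lra).
  (* The witness covers both regimes, because the derivative in the weight needs the optimal noise
     at all weights near [lambda]. *)
  exists (fun l => if Rle_dec ((INR N - 1) * l) (kappa ^ 2 * rho ^ 2) then p_infty
                   else Finite (sqrt (optimal_noise_sq (INR N) kappa rho l))).
  repeat apply conj.
  - intros l hl. destruct (Rle_dec _ _) as [h|h].
    + apply optimal_p_infty; lra.
    + apply optimal_finite; try lra. apply hs; lra.
  - intro h. destruct (Rle_dec _ _) as [_|]; [|contradiction]. split; [|reflexivity].
    intros [[a| |] [ha hu]]; simpl in ha; try contradiction.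
    + pose proof (utility_gain_neg N kappa rho lambda a ltac:(lra) hr hk ha h). lra.
    + rewrite utility_p_infty in hu by assumption. lra.
  - intro h. pose proof (hs lambda h) as hsl.
    (* Since [real p_infty] is 0, the closed formula describes the squared optimum only above the
       threshold. That condition is open in [l], so the formula holds near [lambda] and its
       derivative carries over. *)
    assert (hloc : locally lambda (fun l =>
              optimal_noise_sq (INR N) kappa rho l
              = real (if Rle_dec ((INR N - 1) * l) (kappa ^ 2 * rho ^ 2) then p_infty
                      else Finite (sqrt (optimal_noise_sq (INR N) kappa rho l))) ^ 2)).
    { apply (filter_imp (fun l => kappa ^ 2 * rho ^ 2 / (INR N - 1) < l)).
      - intros l hl. apply Rlt_div_l in hl; [|lra].
        destruct (Rle_dec _ _) as [|_]; [lra|]. simpl real.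
        rewrite pow2_sqrt; [reflexivity|].
        left. apply optimal_noise_sq_pos; try lra. apply hs; lra.
      - apply open_gt. apply Rlt_div_l; lra. }
    pose proof (locally_singleton _ _ hloc) as hsq. cbv beta in hsq.
    assert (hd : 0 < 2 * sqrt ((INR N - 1) * lambda)
                     * (sqrt ((INR N - 1) * lambda) - kappa * rho) ^ 2).
    { assert (0 < kappa * rho) by nra. apply Rmult_lt_0_compat; nra. }
    pose proof (is_derive_optimal_noise_sq_weight (INR N) kappa rho lambda
                  ltac:(nra) hsl) as hdl.
    pose proof (is_derive_ext_loc _ _ _ _ hloc hdl) as hdl'.
    pose proof (is_derive_optimal_noise_sq_clients (INR N) kappa rho lambda
                  ltac:(lra) hlambda hsl) as hdN.
    pose proof (utility_optimal_noise N kappa rho lambda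
                  ltac:(lra) hr hk hlambda hsl) as hu.
    repeat apply conj.
    + exists (sqrt (optimal_noise_sq (INR N) kappa rho lambda)). split.
      * apply sqrt_lt_R0, optimal_noise_sq_pos; lra.
      * assert (0 < (sqrt ((INR N - 1) * lambda) - kappa * rho) ^ 2 / (INR N * rho))
          by (apply Rdiv_lt_0_compat; nra).
        lra.
    + destruct (Rle_dec _ _); [lra | reflexivity].
    + symmetry. exact hsq.
    + destruct (Rle_dec _ _); [lra | exact hu].
    + eexists. exact hdl'.
    + refine (Rle_trans _ _ _ (Req_le _ _ (is_derive_unique _ _ _ hdl')) _).
      apply Ropp_le_cancel. rewrite Ropp_involutive, Ropp_0.
      apply Rdiv_le_0_compat; [|exact hd].
      assert (0 < INR N * kappa) by nra. nra.
    + eexists. exact hdN.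
    (* The positive first factor of the derivative drops out of the sign. *)
    + refine (eq_trans (f_equal sign (is_derive_unique _ _ _ hdN)) (sign_pos_mult _ _ _)).
      apply Rdiv_lt_0_compat; [|exact hd].
      apply Rmult_lt_0_compat; [assumption | now apply sqrt_lt_R0].
Qed.
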